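(* Let $m$ be a multiplicity on a category $\mathcal{C}$. Then the following hold. (1) For any objects $X$ and $Y$ of $\mathcal{C}$, $m(X:Y)\geq 1$. (2) For any object $X$ of $\mathcal{C}$, $m(X:X)=1$. (3) For any objects $X$, $Y$ and $Z$ of $\mathcal{C}$, \[ m(X:Z)\leq m(X:Y)\,m(Y:Z). \]
   Context: The order, addition and multiplication of $\mathbb{R}$ are extended to $\mathbb{R}\cup\{\infty\}$ in the usual way: $r\leq\infty$, $r+\infty=\infty+r=\infty+\infty=\infty$ for real $r$, and $r\cdot\infty=\infty\cdot r=\infty\cdot\infty=\infty$ for positive real $r$. A multiplicity $m$ on a category $\mathcal{C}$ assigns to each morphism $f:X\to Y$ an element $m(f)\in\mathbb{R}_{\geq 1}\cup\{\infty\}$ such that $m(\mathrm{id}_X)=1$ for every object $X$, and $m(g\circ f)\leq m(f)m(g)$ for all morphisms $f:X\to Y$, $g:Y\to Z$. The multiplicity of $X$ over $Y$, denoted $m(X:Y)$, is the infimum of $m(f)$ over all morphisms $f:X\to Y$; if there is no morphism from $X$ to $Y$, then $m(X:Y)=\infty$. *)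

(* Defs.v *)
From HB Require Import structures.
From mathcomp Require Import all_boot all_order all_algebra.
From mathcomp Require Import all_classical all_reals ereal.

Set Implicit Arguments.
Unset Strict Implicit.
Unset Printing Implicit Defensive.

Import Order.TTheory GRing.Theory Num.Theory.

Local Open Scope classical_set_scope.
Local Open Scope ring_scope.
Local Open Scope ereal_scope.

Record category := Category {
  obj :> Type;
  mor : obj -> obj -> Type;
  idm : forall X, mor X X;
  compm : forall X Y Z, mor Y Z -> mor X Y -> mor X Z;
  compm_idl : forall X Y (f : mor X Y), compm (idm Y) f = f;
  compm_idr : forall X Y (f : mor X Y), compm f (idm X) = f;
  compmA : forall X Y Z W (h : mor Z W) (g : mor Y Z) (f : mor X Y),
    compm h (compm g f) = compm (compm h g) f
}.

(* The codomain {r | r >= 1} with infinity adjoined is encoded as \bar R with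
   the constraint mult_ge1. In \bar R, 0 * +oo = 0, but the products below
   only involve elements >= 1. *)
Record multiplicity (R : realType) (C : category) := Multiplicity {
  mult : forall X Y : C, mor X Y -> \bar R;
  mult_ge1 : forall (X Y : C) (f : mor X Y), 1 <= mult f;
  mult_id : forall X : C, mult (idm X) = 1;
  mult_comp : forall (X Y Z : C) (f : mor X Y) (g : mor Y Z),
    mult (compm g f) <= mult f * mult g
}.

(* When mor X Y is empty this is +oo, since ereal_inf set0 = +oo. *)
Definition mult_over (R : realType) (C : category) (m : multiplicity R C)
    (X Y : C) : \bar R :=
  ereal_inf [set mult m f | f in [set: mor X Y]].

(* Main.v *)
Require Import Defs.
From HB Require Import structures.
From mathcomp Require Import all_boot all_order all_algebra.
From mathcomp Require Import all_classical all_reals ereal.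

(** Each [m(f)] is at least 1, hence so is the infimum [m(X:Y)], and [m(X:X)]
    is attained at the identity.  For the triangle inequality, every pair
    [f : X -> Y], [g : Y -> Z] gives [m(X:Z) <= m(g o f) <= m(f) m(g)]; it
    remains to take the infimum over [g] and then over [f] on the right.  This
    is [le_mule_ereal_inf], which is applicable because all the quantities
    involved are positive; when there are no morphisms, the infimum is
    infinite and so is its product with a positive quantity. *)

Set Implicit Arguments.
Unset Strict Implicit.
Unset Printing Implicit Defensive.

Import Order.TTheory GRing.Theory Num.Theory.
Local Open Scope ring_scope.
Local Open Scope ereal_scope.

(** If [c] is finite, dividing by it turns the hypothesis into a lower bound of
    [A].  If [c] is infinite there is no division, but then [c * ereal_inf A]
    is infinite; this is where a positive infimum matters, since
    [+oo * 0 = 0]. *)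
Lemma le_mule_ereal_inf (R : realType) (A : set (\bar R)) (a c : \bar R) :
  0 < c -> 0 < ereal_inf A -> (forall x, A x -> a <= c * x) ->
  a <= c * ereal_inf A.
Proof.
case: c => [c| |] // c_gt0 infA_gt0 leA; last by rewrite gt0_mulye ?leey.
rewrite lte_fin in c_gt0.
rewrite -lee_pdivrMl//; apply: le_ereal_inf_tmp => x Ax.
by rewrite lee_pdivrMl// leA.
Qed.

Lemma mult_over_le (R : realType) (C : category) (m : multiplicity R C)
    (X Y : C) (f : mor X Y) : mult_over m X Y <= mult m f.
Proof. by apply: ereal_inf_lbound; exists f. Qed.

Lemma mult_over_ge1 (R : realType) (C : category) (m : multiplicity R C)
    (X Y : C) : 1 <= mult_over m X Y.
Proof. by apply: le_ereal_inf_tmp => _ [f _ <-]; exact: mult_ge1. Qed.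

Lemma mult_over_id (R : realType) (C : category) (m : multiplicity R C)
    (X : C) : mult_over m X X = 1.
Proof.
by apply/eqP; rewrite eq_le mult_over_ge1 andbT -(mult_id m X) mult_over_le.
Qed.

Lemma mult_over_triangle (R : realType) (C : category) (m : multiplicity R C)
    (X Y Z : C) : mult_over m X Z <= mult_over m X Y * mult_over m Y Z.
Proof.
have over_gt0 U V : 0 < mult_over m U V.
  by apply: lt_le_trans (mult_over_ge1 m U V); rewrite lte_fin ltr01.
rewrite muleC; apply: le_mule_ereal_inf; [exact: over_gt0|exact: over_gt0|].
move=> _ [f _ <-]; rewrite muleC.
apply: le_mule_ereal_inf; [|exact: over_gt0|move=> _ [g _ <-]].
  by apply: lt_le_trans (mult_ge1 m f); rewrite lte_fin ltr01.
exact: le_trans (mult_over_le m (compm g f)) (mult_comp m f g).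
Qed.

Theorem proposition1p1 (R : realType) (C : category) (m : multiplicity R C) :
  (forall X Y : C, 1 <= mult_over m X Y) /\
  (forall X : C, mult_over m X X = 1) /\
  (forall X Y Z : C,
     mult_over m X Z <= mult_over m X Y * mult_over m Y Z).
Proof.
split; first exact: mult_over_ge1.
split; first exact: mult_over_id.
exact: mult_over_triangle.
Qed.
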